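(* Let $A\subseteq\mathbb{N}$ and let $f\colon\deg_e(A)\to\mathcal{P}(\mathbb{N})$ be uniformly $e$-invariant. If $f$ is not constant (i.e. there are $B,C\in\deg_e(A)$ with $f(B)\neq f(C)$), then $A\le_e f(A)$ or $A^\diamond\le_e f(A)$.
   Context: Enumeration reducibility: for $A,B\subseteq\mathbb{N}$, $A\le_e B$ if $A=\Gamma(B):=\{n:\exists D\subseteq B,\ \langle n,D\rangle\in\Gamma\}$ for some c.e. set $\Gamma$ of pairs $\langle n,D\rangle$ with $D$ finite (canonical index); $(\Gamma_i)_{i\in\mathbb{N}}$ is the standard computable numbering of these enumeration operators. $A\equiv_e B$ iff $A\le_e B\le_e A$; $\deg_e(A)=\{B\subseteq\mathbb{N}: B\equiv_e A\}$. Let $\mathcal{X}\subseteq\mathcal{P}(\mathbb{N})$ be closed under $\equiv_e$. A function $f\colon\mathcal{X}\to\mathcal{P}(\mathbb{N})$ is $e$-invariant if $A\equiv_e B$ implies $f(A)\equiv_e f(B)$. Write $A\equiv_e B$ via $\langle i,j\rangle$ if $\Gamma_i(A)=B$ and $\Gamma_j(B)=A$ (with $\langle\cdot,\cdot\rangle$ a fixed computable pairing bijection). A function $u\colon\mathbb{N}\to\mathbb{N}$ is a uniformity function for $f$ if for all $A,B\in\mathcal{X}$ and all $i,j$, whenever $A\equiv_e B$ via $\langle i,j\rangle$ then $f(A)\equiv_e f(B)$ via $u(\langle i,j\rangle)$. $f$ is uniformly $e$-invariant if it has some uniformity function. For $A\subseteq\mathbb{N}$, $K_A=\{\langle i,n\rangle: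 n\in\Gamma_i(A)\}$ and the skip of $A$ is $A^\diamond=\mathbb{N}\setminus K_A$. *)

(* Defs.v *)
From Stdlib Require Import Arith List.
Import ListNotations.

Definition cpair (x y : nat) : nat := (x + y) * S (x + y) / 2 + y.

(* Canonical index of finite sets: D_k = { m | bit m of k is 1 }. *)
Definition canon (k : nat) (m : nat) : Prop := Nat.testbit k m = true.

(* Syntax of mu-recursive programs (untyped arities; arguments as a list). *)
Inductive prog : Type :=
| PZero : prog
| PSucc : prog
| PProj : nat -> prog
| PComp : prog -> list prog -> prog
| PPrim : prog -> prog -> prog
| PMu   : prog -> prog.

Inductive eval : prog -> list nat -> nat -> Prop :=
| eZero xs : eval PZero xs 0
| eSucc xs : eval PSucc xs (S (hd 0 xs))
| eProj i xs : eval (PProj i) xs (nth i xs 0)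
| eComp f gs xs ys y : evals gs xs ys -> eval f ys y -> eval (PComp f gs) xs y
| ePrim0 f g xs y : eval f xs y -> eval (PPrim f g) (0 :: xs) y
| ePrimS f g n xs r y :
    eval (PPrim f g) (n :: xs) r -> eval g (n :: r :: xs) y ->
    eval (PPrim f g) (S n :: xs) y
| eMu f xs y :
    eval f (y :: xs) 0 ->
    (forall z, z < y -> exists r, eval f (z :: xs) (S r)) ->
    eval (PMu f) xs y
with evals : list prog -> list nat -> list nat -> Prop :=
| esNil xs : evals [] xs []
| esCons g gs xs y ys : eval g xs y -> evals gs xs ys -> evals (g :: gs) xs (y :: ys).

Fixpoint encode (p : prog) : nat :=
  match p with
  | PZero => cpair 0 0
  | PSucc => cpair 1 0
  | PProj i => cpair 2 i
  | PComp f gs =>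
      cpair 3 (cpair (encode f)
        ((fix encl (l : list prog) : nat :=
            match l with [] => 0 | g :: l' => S (cpair (encode g) (encl l')) end) gs))
  | PPrim f g => cpair 4 (cpair (encode f) (encode g))
  | PMu f => cpair 5 (encode f)
  end.

(* W_e : the e-th c.e. set (domain of the e-th unary partial recursive
   function; indices that code no program give the empty set). *)
Definition W (e : nat) (x : nat) : Prop :=
  exists p, encode p = e /\ exists y, eval p [x] y.

Definition Gamma (i : nat) (A : nat -> Prop) : nat -> Prop :=
  fun n => exists k, W i (cpair n k) /\ (forall m, canon k m -> A m).

Definition e_le (A B : nat -> Prop) : Prop := exists i, Gamma i B = A.
Definition e_equiv (A B : nat -> Prop) : Prop := e_le A B /\ e_le B A.

Definition edeg (A : nat -> Prop) (B : nat -> Prop) : Prop := e_equiv B A.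

Definition equiv_via (A B : nat -> Prop) (k : nat) : Prop :=
  exists i j, k = cpair i j /\ Gamma i A = B /\ Gamma j B = A.

Definition uniformity_fun (X : (nat -> Prop) -> Prop)
  (f : (nat -> Prop) -> (nat -> Prop)) (u : nat -> nat) : Prop :=
  forall A B, X A -> X B -> forall i j,
    equiv_via A B (cpair i j) -> equiv_via (f A) (f B) (u (cpair i j)).

Definition unif_e_invariant (X : (nat -> Prop) -> Prop)
  (f : (nat -> Prop) -> (nat -> Prop)) : Prop :=
  exists u, uniformity_fun X f u.

Definition KA (A : nat -> Prop) (x : nat) : Prop :=
  exists i n, x = cpair i n /\ Gamma i A n.
Definition skip (A : nat -> Prop) : nat -> Prop := fun x => ~ KA A x.

(* Main.v *)
(** If [f] takes equal values on every pair [P ⊆ R] in the degree of [A] from which a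
single operator recovers [A], then [f (B + ∅) = f (B + C) = f (∅ + C) = f (C + C)
= f (C + ∅)] for all [B] and [C] in the degree. Since [f B] is enumerated from
[f (B + ∅)] by an operator independent of [B], this makes [f] constant. So [f]
separates some such pair, say at [k]. Put [X n = R] if [n] is in [K_A] and [X n = P]
otherwise; [X n] is enumeration equivalent to [A] uniformly in [n], and whether
[k] is in [f (X n)] tells whether [n] is in [K_A]. As [f (X n)] is enumerated from
[f A] uniformly in [n], [f A] enumerates [K_A] or its complement, according to
whether [k] is in [f R] or in [f P]. *)

From Stdlib Require Import Arith List Lia Classical FunctionalExtensionality
  PropExtensionality.
Require Import Defs.
Import ListNotations.

(** * Evaluation of programs *)

(** [X n] can be listed from [A] because [P] is contained in [R]: list [P], and add [R] once [n]
    appears in K_A, so that nothing is ever withdrawn. Having one operator for both [P] and [R]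
    makes the way back independent of whether [n] lies in K_A. Consecutive joins in the chain are
    nested and agree on a column that is [B] or [C], from which [A] is recovered; this is why the
    chain passes through joins with the empty set. K_A involves every operator at once, so a
    universal operator is needed for programs known only through their evaluation rules. Instead of
    counting the steps of an interpreter, enumerability is made a predicate, [enum_op], closed under
    conjunction, disjunction, existential and bounded universal quantification, oracle substitution
    and least fixed points; evaluation is then the least fixed point of its own rules. *)

Lemma eval_evals_ind (P : prog -> list nat -> nat -> Prop)
  (Q : list prog -> list nat -> list nat -> Prop) :
  (forall xs, P PZero xs 0) ->
  (forall xs, P PSucc xs (S (hd 0 xs))) ->
  (forall i xs, P (PProj i) xs (nth i xs 0)) ->
  (forall f gs xs ys y, Q gs xs ys -> P f ys y -> P (PComp f gs) xs y) ->
  (forall f g xs y, P f xs y -> P (PPrim f g) (0 :: xs) y) ->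
  (forall f g n xs r y, P (PPrim f g) (n :: xs) r -> P g (n :: r :: xs) y ->
    P (PPrim f g) (S n :: xs) y) ->
  (forall f xs y, P f (y :: xs) 0 ->
    (forall z, z < y -> exists r, P f (z :: xs) (S r)) -> P (PMu f) xs y) ->
  (forall xs, Q [] xs []) ->
  (forall g gs xs y ys, P g xs y -> Q gs xs ys -> Q (g :: gs) xs (y :: ys)) ->
  (forall p xs y, eval p xs y -> P p xs y) /\
  (forall gs xs ys, evals gs xs ys -> Q gs xs ys).
Proof.
  intros hZ hS hProj hComp hPrim0 hPrimS hMu hNil hCons.
  assert (F : forall p xs y, eval p xs y -> P p xs y).
  { fix F 4 with (G gs xs ys (H : evals gs xs ys) {struct H} : Q gs xs ys).
    - intros p xs y H. destruct H as [ | | | f gs xs ys y H1 H2 | f g xs y H1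
        | f g n xs r y H1 H2 | f xs y H1 H2].
      + apply hZ.
      + apply hS.
      + apply hProj.
      + exact (hComp _ _ _ _ _ (G _ _ _ H1) (F _ _ _ H2)).
      + exact (hPrim0 _ _ _ _ (F _ _ _ H1)).
      + exact (hPrimS _ _ _ _ _ _ (F _ _ _ H1) (F _ _ _ H2)).
      (* In the minimization rule [eval] is hidden under an existential; destructing [H2 z hz]
         exposes a smaller derivation on which [F] may recurse. *)
      + refine (hMu _ _ _ (F _ _ _ H1) (fun z hz => _)).
        destruct (H2 z hz) as [r Hr]. exists r. exact (F _ _ _ Hr).
    - intros gs xs ys H. destruct H as [ | g gs xs y ys H1 H2].
      + apply hNil.
      + exact (hCons _ _ _ _ _ (F _ _ _ H1) (G _ _ _ H2)). }
  split; [exact F|].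
  intros gs xs ys H; induction H; eauto.
Qed.

Lemma eval_functional p xs y y' : eval p xs y -> eval p xs y' -> y = y'.
Proof.
  intros H. revert y'. revert p xs y H.
  apply (eval_evals_ind (fun p xs y => forall y', eval p xs y' -> y = y')
    (fun gs xs ys => forall ys', evals gs xs ys' -> ys = ys')).
  - intros xs y' H; inversion H; auto.
  - intros xs y' H; inversion H; auto.
  - intros i xs y' H; inversion H; auto.
  - intros f gs xs ys y IHs IH y' H; inversion H; subst.
    assert (ys = ys0) by auto. subst; auto.
  - intros f g xs y IH y' H; inversion H; subst; auto.
  - intros f g n xs r y IHr IH y' H; inversion H; subst.
    assert (r = r0) by auto. subst; auto.
  - intros f xs y IH IHz y' H; inversion H as [ | | | | | | f0 xs0 y0 H1 H2]; subst.
    destruct (lt_eq_lt_dec y y') as [[l|e]|l]; auto.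
    + destruct (H2 y l) as [r Hr]. discriminate (IH _ Hr).
    + destruct (IHz y' l) as [r Hr]. discriminate (Hr _ H1).
  - intros xs y' H; inversion H; auto.
  - intros g gs xs y ys IH IHs y' H; inversion H; subst. f_equal; auto.
Qed.

(** * Pairing *)

(** Triangular numbers, written with [nat_rect] so that they match the recursion scheme of [tot_rec]
    by conversion. *)
Definition tri (n : nat) : nat := nat_rect (fun _ => nat) 0 (fun i r => r + S i) n.

(* The largest [w] with [tri w <= n]. *)
Definition tri_root (n : nat) : nat :=
  nat_rect (fun _ => nat) 0 (fun i r => r + (1 - (tri (S r) - S i))) n.

Definition csnd (n : nat) : nat := n - tri (tri_root n).
Definition cfst (n : nat) : nat := tri_root n - csnd n.

Lemma tri_S n : tri (S n) = tri n + S n.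
Proof. reflexivity. Qed.

Lemma cpair_tri x y : cpair x y = tri (x + y) + y.
Proof.
  unfold cpair. f_equal. generalize (x + y) as n. intros n.
  symmetry. apply (Nat.div_unique _ _ _ 0); [lia|].
  induction n as [|n IH]; [reflexivity|]. rewrite tri_S. nia.
Qed.

Lemma tri_mono m n : m <= n -> tri m <= tri n.
Proof. induction 1; rewrite ?tri_S; lia. Qed.

(** From [n] to [S n] the root grows by at most one: [1 - (tri (S r) - S n)] is 1 exactly when the
    next triangular number has been reached. *)
Lemma tri_root_spec n : tri (tri_root n) <= n < tri (S (tri_root n)).
Proof.
  induction n as [|n IH]; [cbn; lia|].
  change (tri_root (S n)) with
    (tri_root n + (1 - (tri (S (tri_root n)) - S n))).
  set (r := tri_root n) in *.
  destruct (le_lt_dec (tri (S r)) (S n)) as [h|h].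
  - replace (tri (S r) - S n) with 0 by lia.
    replace (r + (1 - 0)) with (S r) by lia.
    rewrite (tri_S (S r)). lia.
  - replace (1 - (tri (S r) - S n)) with 0 by lia.
    rewrite Nat.add_0_r. lia.
Qed.

Lemma tri_root_cpair x y : tri_root (cpair x y) = x + y.
Proof.
  pose proof (tri_root_spec (cpair x y)) as [h1 h2].
  rewrite cpair_tri in *. set (r := tri_root _) in *.
  destruct (lt_eq_lt_dec r (x + y)) as [[l|e]|l]; auto.
  - pose proof (tri_mono (S r) (x + y) l). lia.
  - pose proof (tri_mono (S (x + y)) r l). rewrite tri_S in *. lia.
Qed.

Lemma csnd_cpair x y : csnd (cpair x y) = y.
Proof. unfold csnd. rewrite tri_root_cpair, cpair_tri. lia. Qed.

Lemma cfst_cpair x y : cfst (cpair x y) = x.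
Proof. unfold cfst. rewrite tri_root_cpair, csnd_cpair. lia. Qed.

Lemma cpair_eta n : cpair (cfst n) (csnd n) = n.
Proof.
  pose proof (tri_root_spec n) as [h1 h2]. rewrite tri_S in h2.
  rewrite cpair_tri. unfold cfst.
  replace (tri_root n - csnd n + csnd n) with (tri_root n)
    by (unfold csnd; lia).
  unfold csnd; lia.
Qed.

Lemma cfst_0 : cfst 0 = 0.
Proof. reflexivity. Qed.

Lemma csnd_0 : csnd 0 = 0.
Proof. reflexivity. Qed.

Lemma csnd_le n : csnd n <= n.
Proof. unfold csnd. lia. Qed.

Lemma cpair_inj x y x' y' : cpair x y = cpair x' y' -> x = x' /\ y = y'.
Proof.
  intros h. split.
  - rewrite <- (cfst_cpair x y), h. apply cfst_cpair.
  - rewrite <- (csnd_cpair x y), h. apply csnd_cpair.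
Qed.

(** * Total computable functions *)

(** Argument lists of every length are allowed: missing entries read as 0, and [PPrim], which is
    stuck on the empty list, is only used behind a [PComp] that supplies its arguments. *)
Definition tot (F : list nat -> nat) : Prop := exists p, forall xs, eval p xs (F xs).

Lemma tot_nth i : tot (fun xs => nth i xs 0).
Proof. exists (PProj i). constructor. Qed.

Lemma tot_comp1 f E : tot (fun xs => f (nth 0 xs 0)) -> tot E -> tot (fun xs => f (E xs)).
Proof.
  intros [p hp] [q hq]. exists (PComp p [q]). intros xs.
  apply eComp with [E xs]; [repeat constructor; auto | apply (hp [E xs])].
Qed.

Lemma tot_comp2 f E1 E2 :
  tot (fun xs => f (nth 0 xs 0) (nth 1 xs 0)) -> tot E1 -> tot E2 ->
  tot (fun xs => f (E1 xs) (E2 xs)).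
Proof.
  intros [p hp] [q1 h1] [q2 h2]. exists (PComp p [q1; q2]). intros xs.
  apply eComp with [E1 xs; E2 xs];
    [repeat constructor; auto | apply (hp [E1 xs; E2 xs])].
Qed.

Lemma tot_S E : tot E -> tot (fun xs => S (E xs)).
Proof.
  apply tot_comp1. exists PSucc. intros [|x xs]; constructor.
Qed.

Lemma tot_const c : tot (fun _ => c).
Proof.
  induction c as [|c IH]; [exists PZero; constructor | exact (tot_S _ IH)].
Qed.

Lemma tot_rec G H E N :
  tot (fun xs => G (nth 0 xs 0)) ->
  tot (fun xs => H (nth 0 xs 0) (nth 1 xs 0) (nth 2 xs 0)) ->
  tot E -> tot N ->
  tot (fun xs => nat_rect (fun _ => nat) (G (E xs)) (fun n r => H n r (E xs)) (N xs)).
Proof.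
  intros [g hg] [h hh] [e he] [n hn].
  exists (PComp (PPrim g h) [n; e]). intros xs.
  apply eComp with [N xs; E xs]; [repeat constructor; auto|].
  generalize (N xs) as m. induction m as [|m IH]; cbn.
  - constructor. apply (hg [E xs]).
  - eapply ePrimS; [exact IH|].
    match goal with |- eval h ?l _ => exact (hh l) end.
Qed.

Lemma tot_add E1 E2 : tot E1 -> tot E2 -> tot (fun xs => E1 xs + E2 xs).
Proof.
  apply (tot_comp2 Nat.add).
  assert (e : (fun xs : list nat => nth 0 xs 0 + nth 1 xs 0) = fun xs =>
    nat_rect (fun _ => nat) (nth 0 xs 0) (fun _ r => S r) (nth 1 xs 0)).
  { apply functional_extensionality; intros xs.
    induction (nth 1 xs 0) as [|n IH]; cbn; rewrite <- ?IH; lia. }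
  rewrite e. apply (tot_rec (fun x => x) (fun _ r _ => S r));
    auto using tot_nth, tot_S.
Qed.

Lemma tot_pred E : tot E -> tot (fun xs => pred (E xs)).
Proof.
  apply (tot_comp1 pred).
  assert (e : (fun xs : list nat => pred (nth 0 xs 0)) = fun xs =>
    nat_rect (fun _ => nat) 0 (fun n _ => n) (nth 0 xs 0)).
  { apply functional_extensionality; intros xs. now destruct (nth 0 xs 0). }
  rewrite e. apply (tot_rec (fun _ => 0) (fun n _ _ => n) (fun xs => nth 0 xs 0));
    auto using tot_nth, tot_const.
Qed.

Lemma tot_sub E1 E2 : tot E1 -> tot E2 -> tot (fun xs => E1 xs - E2 xs).
Proof.
  apply (tot_comp2 Nat.sub).
  assert (e : (fun xs : list nat => nth 0 xs 0 - nth 1 xs 0) = fun xs =>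
    nat_rect (fun _ => nat) (nth 0 xs 0) (fun _ r => pred r) (nth 1 xs 0)).
  { apply functional_extensionality; intros xs.
    induction (nth 1 xs 0) as [|n IH]; cbn; rewrite <- ?IH; lia. }
  rewrite e. apply (tot_rec (fun x => x) (fun _ r _ => pred r));
    auto using tot_nth, tot_pred.
Qed.

Lemma tot_tri E : tot E -> tot (fun xs => tri (E xs)).
Proof.
  apply (tot_comp1 tri).
  apply (tot_rec (fun _ => 0) (fun i r _ => r + S i) (fun xs => nth 0 xs 0));
    auto using tot_nth, tot_const, tot_add, tot_S.
Qed.

Lemma tot_tri_root E : tot E -> tot (fun xs => tri_root (E xs)).
Proof.
  apply (tot_comp1 tri_root).
  apply (tot_rec (fun _ => 0) (fun i r _ => r + (1 - (tri (S r) - S i)))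
    (fun xs => nth 0 xs 0)); auto 20 using tot_nth, tot_const, tot_add, tot_S, tot_sub, tot_tri.
Qed.

Lemma tot_cpair E1 E2 : tot E1 -> tot E2 -> tot (fun xs => cpair (E1 xs) (E2 xs)).
Proof.
  intros h1 h2.
  assert (e : (fun xs => cpair (E1 xs) (E2 xs)) = fun xs => tri (E1 xs + E2 xs) + E2 xs)
    by (apply functional_extensionality; intros; apply cpair_tri).
  rewrite e. auto using tot_add, tot_tri.
Qed.

(* With pairing available, unary functions of a single number coding the whole
   environment suffice. *)
Definition computable (f : nat -> nat) : Prop := tot (fun xs => f (nth 0 xs 0)).

Lemma computable_id : computable (fun e => e).
Proof. apply tot_nth. Qed.

Lemma computable_const c : computable (fun _ => c).
Proof. exact (tot_const c). Qed.

Lemma computable_comp f g : computable f -> computable g -> computable (fun e => f (g e)).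
Proof. intros hf hg. exact (tot_comp1 f _ hf hg). Qed.

Lemma computable_S f : computable f -> computable (fun e => S (f e)).
Proof. exact (tot_S _). Qed.

Lemma computable_add f g : computable f -> computable g -> computable (fun e => f e + g e).
Proof. exact (tot_add _ _). Qed.

Lemma computable_sub f g : computable f -> computable g -> computable (fun e => f e - g e).
Proof. exact (tot_sub _ _). Qed.

Lemma computable_pred f : computable f -> computable (fun e => pred (f e)).
Proof. exact (tot_pred _). Qed.

Lemma computable_cpair f g :
  computable f -> computable g -> computable (fun e => cpair (f e) (g e)).
Proof. exact (tot_cpair _ _). Qed.

Lemma computable_csnd f : computable f -> computable (fun e => csnd (f e)).
Proof. intros h. unfold csnd. apply tot_sub; auto using tot_tri, tot_tri_root. Qed.

Lemma computable_cfst f : computable f -> computable (fun e => cfst (f e)).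
Proof.
  intros h. apply tot_sub; auto using tot_tri_root. exact (computable_csnd f h).
Qed.

Lemma computable_rec g h n :
  computable g ->
  computable (fun z => h (cfst z) (cfst (csnd z)) (csnd (csnd z))) ->
  computable n ->
  computable (fun e => nat_rect (fun _ => nat) (g e) (fun i r => h i r e) (n e)).
Proof.
  intros hg hh hn. apply (tot_rec g h); auto using tot_nth.
  assert (e : (fun xs => h (nth 0 xs 0) (nth 1 xs 0) (nth 2 xs 0)) = fun xs : list nat =>
    (fun z => h (cfst z) (cfst (csnd z)) (csnd (csnd z)))
      (cpair (nth 0 xs 0) (cpair (nth 1 xs 0) (nth 2 xs 0)))).
  { apply functional_extensionality; intros xs.
    now rewrite !csnd_cpair, !cfst_cpair. }
  rewrite e. apply (tot_comp1 (fun z => h (cfst z) (cfst (csnd z)) (csnd (csnd z))));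
    auto using tot_cpair, tot_nth.
Qed.

Lemma computable_ext f g : (forall e, f e = g e) -> computable f -> computable g.
Proof. intros h hf. now replace g with f by now apply functional_extensionality. Qed.

Lemma computable_comp2 f g h :
  computable (fun z => f (cfst z) (csnd z)) -> computable g -> computable h ->
  computable (fun e => f (g e) (h e)).
Proof.
  intros hf hg hh.
  apply (computable_ext (fun e => (fun z => f (cfst z) (csnd z)) (cpair (g e) (h e)))).
  - intros e. now rewrite cfst_cpair, csnd_cpair.
  - apply (computable_comp (fun z => f (cfst z) (csnd z))); auto using computable_cpair.
Qed.

Opaque cpair cfst csnd.

Ltac computable :=
  repeat first
    [ assumption
    | apply computable_id | apply computable_const | apply computable_cfst
    | apply computable_csnd | apply computable_S | apply computable_pred
    | apply computable_cpair | apply computable_add | apply computable_sub ].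

(** * Products, bounded quantifiers, and bits of canonical indices *)

Lemma computable_mul f g : computable f -> computable g -> computable (fun e => f e * g e).
Proof.
  apply (computable_comp2 Nat.mul).
  apply (computable_ext (fun z =>
    nat_rect (fun _ => nat) 0 (fun _ r => r + csnd z) (cfst z))).
  - intros z. induction (cfst z) as [|n IH]; cbn; rewrite ?IH; lia.
  - apply (computable_rec (fun _ => 0) (fun _ r z => r + csnd z)); computable.
Qed.

(** With nonzero read as true, [bsum] is the bounded existential and [bprod] the bounded universal
    quantifier. *)
Definition bsum (f : nat -> nat) (n : nat) : nat :=
  nat_rect (fun _ => nat) 0 (fun i r => r + f i) n.
Definition bprod (f : nat -> nat) (n : nat) : nat :=
  nat_rect (fun _ => nat) 1 (fun i r => r * f i) n.

Lemma bsum_neq0 f n : bsum f n <> 0 <-> exists i, i < n /\ f i <> 0.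
Proof.
  induction n as [|n IH]; cbn.
  - split; [lia | intros (i & h & _); lia].
  - change (bsum f n + f n <> 0 <-> exists i, i < S n /\ f i <> 0). split.
    + intros h. destruct (Nat.eq_dec (f n) 0) as [e|e].
      * destruct (proj1 IH) as (i & hi & hf); [lia|]. exists i; auto.
      * exists n; auto.
    + intros (i & hi & hf). destruct (Nat.eq_dec i n) as [->|e]; [lia|].
      assert (bsum f n <> 0) by (apply IH; exists i; split; auto; lia). lia.
Qed.

Lemma bprod_neq0 f n : bprod f n <> 0 <-> forall i, i < n -> f i <> 0.
Proof.
  induction n as [|n IH]; cbn.
  - split; [intros _ i h; lia | lia].
  - change (bprod f n * f n <> 0 <-> forall i, i < S n -> f i <> 0). split.
    + intros h i hi. destruct (Nat.eq_dec i n) as [->|e]; [nia|].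
      apply IH; nia.
    + intros h. assert (bprod f n <> 0) by (apply IH; auto). specialize (h n). nia.
Qed.

Lemma computable_bsum f n :
  computable (fun z => f (cfst z) (csnd z)) -> computable n ->
  computable (fun e => bsum (fun i => f i e) (n e)).
Proof.
  intros hf hn. apply (computable_rec (fun _ => 0) (fun i r e => r + f i e)); computable.
  apply (computable_comp2 f); computable.
Qed.

Lemma computable_bprod f n :
  computable (fun z => f (cfst z) (csnd z)) -> computable n ->
  computable (fun e => bprod (fun i => f i e) (n e)).
Proof.
  intros hf hn. apply (computable_rec (fun _ => 1) (fun i r e => r * f i e)); computable.
  apply computable_mul; computable. apply (computable_comp2 f); computable.
Qed.

Definition par (n : nat) : nat := nat_rect (fun _ => nat) 0 (fun _ r => 1 - r) n.

Lemma par_odd n : par n = Nat.b2n (Nat.odd n).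
Proof.
  induction n as [|n IH]; [reflexivity|].
  change (1 - par n = Nat.b2n (Nat.odd (S n))).
  rewrite IH, Nat.odd_succ, <- Nat.negb_odd. now destruct (Nat.odd n).
Qed.

Lemma computable_par f : computable f -> computable (fun e => par (f e)).
Proof.
  apply (computable_comp par).
  apply (computable_rec (fun _ => 0) (fun _ r _ => 1 - r)); computable.
Qed.

(** Halving is a sum of parities: [Nat.div2] grows from [n] to [S n] exactly when [n] is odd. *)
Lemma computable_div2 f : computable f -> computable (fun e => Nat.div2 (f e)).
Proof.
  apply (computable_comp Nat.div2).
  apply (computable_ext (fun e =>
    nat_rect (fun _ => nat) 0 (fun i r => r + par i) e)).
  - induction e as [|n IH]; [reflexivity|]. cbn. rewrite IH.
    pose proof (Nat.div2_odd n). pose proof (Nat.div2_odd (S n)).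
    rewrite Nat.odd_succ, <- Nat.negb_odd in H0. rewrite par_odd.
    change (match n with 0 => 0 | S n' => S (Nat.div2 n') end) with (Nat.div2 (S n)).
    destruct (Nat.odd n); cbn [Nat.b2n negb] in *; lia.
  - apply (computable_rec (fun _ => 0) (fun i r _ => r + par i)); computable.
    apply computable_par; computable.
Qed.

Definition bit (k m : nat) : nat := Nat.b2n (Nat.testbit k m).

Lemma bit_canon k m : bit k m <> 0 <-> canon k m.
Proof. unfold bit, canon. destruct (Nat.testbit k m); cbn; intuition discriminate. Qed.

(** Bit [m] of [k] is the parity of [k] after [m] halvings. [Nat.testbit] halves its argument first,
    while the iteration applies the last halving outermost; [comm] reconciles the two orders. *)
Lemma computable_bit f g :
  computable f -> computable g -> computable (fun e => bit (f e) (g e)).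
Proof.
  apply (computable_comp2 bit).
  apply (computable_ext (fun z => par
    (nat_rect (fun _ => nat) (cfst z) (fun _ r => Nat.div2 r) (csnd z)))).
  - intros z. rewrite par_odd. unfold bit. f_equal.
    generalize (cfst z) as k, (csnd z) as m. intros k m. revert k.
    assert (comm : forall m k, nat_rect (fun _ => nat) (Nat.div2 k) (fun _ r => Nat.div2 r) m
      = nat_rect (fun _ => nat) k (fun _ r => Nat.div2 r) (S m)).
    { clear. induction m as [|m IH]; intros k; [reflexivity|].
      cbn in *. now rewrite IH. }
    induction m as [|m IH]; intros k; [reflexivity|].
    rewrite <- comm, IH. cbn. reflexivity.
  - apply computable_par.
    apply (computable_rec (fun z => cfst z) (fun _ r _ => Nat.div2 r)); computable.
    apply computable_div2; computable.
Qed.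

Definition sg (n : nat) : nat := 1 - (1 - n).

(* The canonical index of [{ x < n | f x <> 0 }], built from the top bit down. *)
Definition mkset (f : nat -> nat) (n : nat) : nat :=
  nat_rect (fun _ => nat) 0 (fun i r => 2 * r + sg (f (n - S i))) n.

Lemma canon_mkset f n x : canon (mkset f n) x <-> x < n /\ f x <> 0.
Proof.
  unfold mkset.
  (* After [i] rounds the accumulator holds only the top [i] values, [f (n - i)] to [f (n - 1)],
     with [f (n - i)] at bit 0. *)
  assert (H : forall i, i <= n -> forall x,
    canon (nat_rect (fun _ => nat) 0 (fun i r => 2 * r + sg (f (n - S i))) i) x
      <-> x < i /\ f (n - i + x) <> 0).
  { induction i as [|i IH]; intros hi y.
    - cbn. unfold canon. rewrite Nat.bits_0. split; [discriminate | lia].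
    - cbn [nat_rect]. set (r := nat_rect _ _ _ i) in *.
      assert (hsg : sg (f (n - S i)) = Nat.b2n (negb (f (n - S i) =? 0))).
      { unfold sg. destruct (Nat.eqb_spec (f (n - S i)) 0); cbn [negb Nat.b2n]; lia. }
      rewrite hsg. destruct y as [|y]; unfold canon in *.
      + rewrite Nat.testbit_0_r, Nat.add_0_r.
        destruct (Nat.eqb_spec (f (n - S i)) 0); cbn; intuition (auto; try discriminate; lia).
      + rewrite Nat.testbit_succ_r, IH by lia.
        replace (n - S i + S y) with (n - i + y) by lia. intuition lia. }
  rewrite H by lia. now rewrite Nat.sub_diag.
Qed.

Lemma computable_mkset f n :
  computable (fun z => f (cfst z) (csnd z)) -> computable n ->
  computable (fun e => mkset (fun i => f i e) (n e)).
Proof.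
  intros hf hn. unfold mkset, sg.
  apply (computable_rec (fun _ => 0) (fun i r e => 2 * r + (1 - (1 - f (n e - S i) e))));
    computable.
  apply (computable_comp2 f); computable. apply (computable_comp n); computable.
Qed.

(** * Enumeration operators *)

Lemma computable_comp4 f a b c d :
  computable (fun z => f (cfst z) (cfst (csnd z)) (cfst (csnd (csnd z)))
    (csnd (csnd (csnd z)))) ->
  computable a -> computable b -> computable c -> computable d ->
  computable (fun e => f (a e) (b e) (c e) (d e)).
Proof.
  intros hf ha hb hc hd.
  apply (computable_ext (fun e => (fun z => f (cfst z) (cfst (csnd z))
    (cfst (csnd (csnd z))) (csnd (csnd (csnd z))))
      (cpair (a e) (cpair (b e) (cpair (c e) (d e)))))).
  - intros e. cbv beta. now rewrite !csnd_cpair, !cfst_cpair.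
  - apply (computable_comp (fun z => f (cfst z) (cfst (csnd z))
    (cfst (csnd (csnd z))) (csnd (csnd (csnd z))))); computable.
Qed.

Definition fin_in (k : nat) (A : nat -> Prop) : Prop := forall m, canon k m -> A m.

Lemma fin_in_refl k : fin_in k (canon k).
Proof. intros m h; exact h. Qed.

Lemma fin_in_0 A : fin_in 0 A.
Proof. intros m h. unfold canon in h. rewrite Nat.bits_0 in h. discriminate. Qed.

Lemma canon_lor k j m : canon (Nat.lor k j) m <-> canon k m \/ canon j m.
Proof. unfold canon. rewrite Nat.lor_spec. apply Bool.orb_true_iff. Qed.

Lemma fin_in_lor k j A : fin_in k A -> fin_in j A -> fin_in (Nat.lor k j) A.
Proof. intros h1 h2 m hm. apply canon_lor in hm as [hm|hm]; auto. Qed.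

Lemma fin_in_lor_l k j : fin_in k (canon (Nat.lor k j)).
Proof. intros m hm. apply canon_lor; auto. Qed.

Lemma fin_in_lor_r k j : fin_in j (canon (Nat.lor k j)).
Proof. intros m hm. apply canon_lor; auto. Qed.

Lemma canon_pow2 n m : canon (2 ^ n) m <-> m = n.
Proof. unfold canon. rewrite Nat.pow2_bits_eqb, Nat.eqb_eq. intuition. Qed.

(** An element [m] contributes [2 ^ m > m] to the index. Quantifiers over a finite set can therefore
    be bounded by its index. *)
Lemma canon_lt k m : canon k m -> m < k.
Proof.
  intros h. apply Nat.nle_gt. intros hle. unfold canon in h.
  rewrite Nat.bits_above_log2 in h; [discriminate|].
  destruct k as [|k]; [rewrite Nat.bits_0 in h; discriminate|].
  apply Nat.log2_lt_pow2; [lia|].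
  apply Nat.le_lt_trans with m; auto. apply Nat.pow_gt_lin_r. lia.
Qed.

(* A relation that is recursively enumerable and positive in the oracles [A] and
   [X]: [F k j s e <> 0] says that [e] has been enumerated by stage [s] using
   only the finite parts [D_k] of [A] and [D_j] of [X]. Monotonicity of [F] lets
   finitely many such witnesses be merged into one. *)
Definition enum_op (P : (nat -> Prop) -> (nat -> Prop) -> nat -> Prop) : Prop :=
  exists F : nat -> nat -> nat -> nat -> nat,
    computable (fun z => F (cfst z) (cfst (csnd z)) (cfst (csnd (csnd z)))
      (csnd (csnd (csnd z)))) /\
    (forall k k' j j' s s' e, fin_in k (canon k') -> fin_in j (canon j') ->
      s <= s' -> F k j s e <> 0 -> F k' j' s' e <> 0) /\
    (forall A X e, P A X e <->
      exists k j s, fin_in k A /\ fin_in j X /\ F k j s e <> 0).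

Lemma enum_op_ext P Q :
  (forall A X e, P A X e <-> Q A X e) -> enum_op P -> enum_op Q.
Proof.
  intros h (F & c & mono & spec). exists F. repeat split; auto; intros H.
  - apply spec, h; auto.
  - apply h, spec; auto.
Qed.

Lemma enum_op_test g : computable g -> enum_op (fun _ _ e => g e <> 0).
Proof.
  intros hg. exists (fun _ _ _ e => g e). split; [|split].
  - apply (computable_comp g); computable.
  - auto.
  - intros A X e. split; [intros h | intros (k & j & s & _ & _ & h); exact h].
    exists 0, 0, 0. auto using fin_in_0.
Qed.

Lemma enum_op_eq f g : computable f -> computable g -> enum_op (fun _ _ e => f e = g e).
Proof.
  intros hf hg. apply (enum_op_ext (fun _ _ e => 1 - ((f e - g e) + (g e - f e)) <> 0)).
  - intros A X e. lia.
  - apply (enum_op_test (fun e => 1 - ((f e - g e) + (g e - f e)))); computable.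
Qed.

Lemma enum_op_oracle t : computable t -> enum_op (fun A _ e => A (t e)).
Proof.
  intros ht. exists (fun k _ _ e => bit k (t e)). split; [|split].
  - apply computable_bit; computable. apply (computable_comp t); computable.
  - intros k k' j j' s s' e hk _ _. rewrite !bit_canon. apply hk.
  - intros A X e. split.
    + intros h. exists (2 ^ t e), 0, 0. rewrite bit_canon, canon_pow2.
      split; [|auto using fin_in_0]. intros m hm. apply canon_pow2 in hm. congruence.
    + intros (k & j & s & h & _ & hb). apply bit_canon in hb. auto.
Qed.

Lemma enum_op_oracle2 t : computable t -> enum_op (fun _ X e => X (t e)).
Proof.
  intros ht. exists (fun _ j _ e => bit j (t e)). split; [|split].
  - apply computable_bit; computable. apply (computable_comp t); computable.
  - intros k k' j j' s s' e _ hj _. rewrite !bit_canon. apply hj.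
  - intros A X e. split.
    + intros h. exists 0, (2 ^ t e), 0. rewrite bit_canon, canon_pow2.
      split; [|split]; auto using fin_in_0.
      intros m hm. apply canon_pow2 in hm. congruence.
    + intros (k & j & s & _ & h & hb). apply bit_canon in hb. auto.
Qed.

Lemma enum_op_subst P t :
  enum_op P -> computable t -> enum_op (fun A X e => P A X (t e)).
Proof.
  intros (F & c & mono & spec) ht. exists (fun k j s e => F k j s (t e)).
  split; [|split].
  - apply (computable_comp4 F); computable. apply (computable_comp t); computable.
  - intros *. apply mono.
  - intros A X e. apply spec.
Qed.

Lemma enum_op_comp2 P t u :
  enum_op (fun A X z => P A X (cfst z) (csnd z)) -> computable t -> computable u ->
  enum_op (fun A X e => P A X (t e) (u e)).
Proof.
  intros hP ht hu. apply (enum_op_ext (fun A X e =>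
    (fun A X z => P A X (cfst z) (csnd z)) A X (cpair (t e) (u e)))).
  - intros A X e. cbv beta. now rewrite cfst_cpair, csnd_cpair.
  - apply (enum_op_subst (fun A X z => P A X (cfst z) (csnd z))); computable.
Qed.

Lemma enum_op_and P Q :
  enum_op P -> enum_op Q -> enum_op (fun A X e => P A X e /\ Q A X e).
Proof.
  intros (F & cF & mF & sF) (G & cG & mG & sG).
  exists (fun k j s e => F k j s e * G k j s e). split; [|split].
  - apply computable_mul; [apply (computable_comp4 F) | apply (computable_comp4 G)];
      computable.
  - intros k k' j j' s s' e hk hj hs h.
    assert (F k' j' s' e <> 0) by (apply (mF k k' j j' s s'); auto; nia).
    assert (G k' j' s' e <> 0) by (apply (mG k k' j j' s s'); auto; nia). nia.
  - intros A X e. rewrite sF, sG. split.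
    + intros [(k1 & j1 & s1 & hk1 & hj1 & h1) (k2 & j2 & s2 & hk2 & hj2 & h2)].
      exists (Nat.lor k1 k2), (Nat.lor j1 j2), (max s1 s2).
      split; [auto using fin_in_lor|]. split; [auto using fin_in_lor|].
      apply (mF _ (Nat.lor k1 k2) _ (Nat.lor j1 j2) _ (max s1 s2)) in h1;
        auto using fin_in_lor_l, Nat.le_max_l.
      apply (mG _ (Nat.lor k1 k2) _ (Nat.lor j1 j2) _ (max s1 s2)) in h2;
        auto using fin_in_lor_r, Nat.le_max_r. nia.
    + intros (k & j & s & hk & hj & h).
      split; exists k, j, s; repeat split; auto; nia.
Qed.

Lemma enum_op_or P Q :
  enum_op P -> enum_op Q -> enum_op (fun A X e => P A X e \/ Q A X e).
Proof.
  intros (F & cF & mF & sF) (G & cG & mG & sG).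
  exists (fun k j s e => F k j s e + G k j s e). split; [|split].
  - apply computable_add; [apply (computable_comp4 F) | apply (computable_comp4 G)];
      computable.
  - intros k k' j j' s s' e hk hj hs h.
    destruct (Nat.eq_dec (F k j s e) 0) as [h0|h0].
    + assert (G k' j' s' e <> 0) by (apply (mG k k' j j' s s'); auto; lia). lia.
    + assert (F k' j' s' e <> 0) by (apply (mF k k' j j' s s'); auto). lia.
  - intros A X e. rewrite sF, sG. split.
    + intros [(k & j & s & hk & hj & h) | (k & j & s & hk & hj & h)];
        exists k, j, s; repeat split; auto; lia.
    + intros (k & j & s & hk & hj & h).
      destruct (Nat.eq_dec (F k j s e) 0) as [h0|h0];
        [right | left]; exists k, j, s; repeat split; auto; lia.
Qed.

Lemma enum_op_ex P :
  enum_op (fun A X z => P A X (cfst z) (csnd z)) -> enum_op (fun A X e => exists y, P A X y e).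
Proof.
  intros (F & c & mono & spec).
  (* The stage [s] also bounds the search for [y], so a later stage keeps every witness found
     before. *)
  exists (fun k j s e => bsum (fun y => F k j s (cpair y e)) (S s)). split; [|split].
  - apply (computable_bsum (fun y z => F (cfst z) (cfst (csnd z)) (cfst (csnd (csnd z)))
      (cpair y (csnd (csnd (csnd z)))))); computable.
    apply (computable_comp4 F); computable.
  - intros k k' j j' s s' e hk hj hs. rewrite !bsum_neq0. intros (y & hy & h).
    exists y. split; [lia|]. exact (mono _ _ _ _ _ _ _ hk hj hs h).
  - assert (spec' : forall A X y e, P A X y e <->
      exists k j s, fin_in k A /\ fin_in j X /\ F k j s (cpair y e) <> 0).
    { intros A X y e. specialize (spec A X (cpair y e)).
      now rewrite cfst_cpair, csnd_cpair in spec. }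
    intros A X e. split.
    + intros [y hy]. apply spec' in hy as (k & j & s & hk & hj & h).
      exists k, j, (max s y). split; [|split]; auto. rewrite bsum_neq0.
      exists y. split; [lia|]. revert h. apply mono; auto using fin_in_refl; lia.
    + intros (k & j & s & hk & hj & h). rewrite bsum_neq0 in h.
      destruct h as (y & _ & h). exists y. apply spec'. exists k, j, s; auto.
Qed.

(** Finitely many witnesses merge into one: unite the finite parts with [Nat.lor], take the maximum
    of the stages, and let [mono] carry the earlier facts along. *)
Lemma collect_stages (R : nat -> nat -> nat -> nat -> Prop) A X n :
  (forall m k k' j j' s s', fin_in k (canon k') -> fin_in j (canon j') -> s <= s' ->
    R m k j s -> R m k' j' s') ->
  (forall m, m < n -> exists k j s, fin_in k A /\ fin_in j X /\ R m k j s) ->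
  exists k j s, fin_in k A /\ fin_in j X /\ forall m, m < n -> R m k j s.
Proof.
  intros mono. induction n as [|n IH]; intros h.
  - exists 0, 0, 0. split; [|split]; auto using fin_in_0. lia.
  - destruct IH as (k1 & j1 & s1 & hk1 & hj1 & h1); [auto|].
    destruct (h n) as (k2 & j2 & s2 & hk2 & hj2 & h2); [auto|].
    exists (Nat.lor k1 k2), (Nat.lor j1 j2), (max s1 s2).
    split; [auto using fin_in_lor|]. split; [auto using fin_in_lor|].
    intros m hm. destruct (Nat.eq_dec m n) as [->|e].
    + revert h2. apply mono; auto using fin_in_lor_r, Nat.le_max_r.
    + generalize (h1 m ltac:(lia)).
      apply mono; auto using fin_in_lor_l, Nat.le_max_l.
Qed.

Lemma enum_op_ball P n :
  enum_op (fun A X z => P A X (cfst z) (csnd z)) -> computable n ->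
  enum_op (fun A X e => forall y, y < n e -> P A X y e).
Proof.
  intros (F & c & mono & spec) hn.
  exists (fun k j s e => bprod (fun y => F k j s (cpair y e)) (n e)). split; [|split].
  - apply (computable_bprod (fun y z => F (cfst z) (cfst (csnd z)) (cfst (csnd (csnd z)))
      (cpair y (csnd (csnd (csnd z)))))); computable.
    + apply (computable_comp4 F); computable.
    + apply (computable_comp n); computable.
  - intros k k' j j' s s' e hk hj hs. rewrite !bprod_neq0. intros h y hy.
    exact (mono _ _ _ _ _ _ _ hk hj hs (h y hy)).
  - assert (spec' : forall A X y e, P A X y e <->
      exists k j s, fin_in k A /\ fin_in j X /\ F k j s (cpair y e) <> 0).
    { intros A X y e. specialize (spec A X (cpair y e)).
      now rewrite cfst_cpair, csnd_cpair in spec. }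
    intros A X e. split.
    + intros h.
      destruct (collect_stages (fun y k j s => F k j s (cpair y e) <> 0) A X (n e))
        as (k & j & s & hk & hj & hF).
      * intros *. apply mono.
      * intros y hy. apply spec'; auto.
      * exists k, j, s. rewrite bprod_neq0. auto.
    + intros (k & j & s & hk & hj & h) y hy. rewrite bprod_neq0 in h.
      apply spec'. exists k, j, s; auto.
Qed.

(* [L A] is the least fixed point of [Theta A]; it is the union of the finite
   stages obtained by iterating the approximations of [Theta] from the empty set. *)
Lemma enum_op_lfp Theta (L : (nat -> Prop) -> nat -> Prop) :
  enum_op Theta ->
  (forall A x, Theta A (L A) x -> L A x) ->
  (forall A X, (forall x, Theta A X x -> X x) -> forall x, L A x -> X x) ->
  enum_op (fun A _ => L A).
Proof.
  intros (F & c & mono & spec) closed least.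
  (* [T k s] is the canonical index of the [s]-th iterate computed from [D_k]. The number [i] serves
     both as stage for [F] and as size bound, which keeps each iterate finite. *)
  set (T := fun k s => nat_rect (fun _ => nat) 0
    (fun i t => mkset (fun x => F k t i x) i) s).
  assert (TS : forall k s x, canon (T k (S s)) x <-> x < s /\ F k (T k s) s x <> 0)
    by (intros; apply (canon_mkset (fun x => F k (T k s) s x))).
  assert (Tmono : forall k k' s s', fin_in k (canon k') -> s <= s' ->
    fin_in (T k s) (canon (T k' s'))).
  { intros k k' s s' hk. revert s'. induction s as [|s IH]; intros s' hs.
    - apply fin_in_0.
    - destruct s' as [|s']; [lia|]. intros x. rewrite !TS. intros [hx h].
      split; [lia|]. revert h. apply mono; auto; [apply IH; lia | lia]. }
  exists (fun k _ s e => bit (T k s) e). split; [|split].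
  - apply computable_bit; computable.
    apply (computable_rec (fun _ => 0)
      (fun i t z => mkset (fun x => F (cfst z) t i x) i)); computable.
    apply (computable_mkset (fun x z =>
      F (cfst (csnd (csnd z))) (cfst (csnd z)) (cfst z) x)); computable.
    apply (computable_comp4 F); computable.
  - intros k k' j j' s s' e hk _ hs. rewrite !bit_canon. apply Tmono; auto.
  - intros A X e. split.
    + intros h.
      assert (h' : exists k s, fin_in k A /\ canon (T k s) e).
      (* Leastness is applied to the union of all iterates. It is closed because a single step
         consults only the finite set [D_j], whose members all lie below [j] and so appear together
         in one iterate. *)
      { revert e h. apply least. intros x hx.
        apply spec in hx as (k & j & s & hk & hj & hF).
        destruct (collect_stages (fun m k _ s => canon j m -> canon (T k s) m)
          A (fun _ => True) j) as (k1 & j1 & s1 & hk1 & _ & h1).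
        - intros m k1 k2 _ _ s1 s2 hk12 _ hs h hm. exact (Tmono _ _ _ _ hk12 hs m (h hm)).
        - intros m hm. destruct (classic (canon j m)) as [hjm|hjm].
          + destruct (hj m hjm) as (k1 & s1 & hk1 & h1).
            exists k1, 0, s1. split; [|split]; auto using fin_in_0.
          + exists 0, 0, 0. split; [|split]; auto using fin_in_0. intros; contradiction.
        (* [s] is needed for the computation of [F], [s1] for [D_j] to be present, and [S x] for [x]
           to pass the size bound. *)
        - set (K := Nat.lor k k1). set (s2 := max (max s s1) (S x)).
          exists K, (S s2). split; [apply fin_in_lor; auto|].
          apply TS. split; [lia|]. revert hF. apply mono.
          + apply fin_in_lor_l.
          + intros m hm. apply (Tmono k1 K s1 s2).
            * apply fin_in_lor_r.
            * lia.
            * apply h1; auto. apply canon_lt; auto.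
          + lia. }
      destruct h' as (k & s & hk & hT). exists k, 0, s.
      rewrite bit_canon. auto using fin_in_0.
    + intros (k & _ & s & hk & _ & h). apply bit_canon in h. revert e h.
      induction s as [|s IH]; intros e h.
      * destruct (fin_in_0 (fun _ => False) e h).
      (* The previous iterate, contained in [L A] by induction, is itself the finite part [j]
         required by [spec]. *)
      * apply TS in h as [_ h]. apply closed, spec. exists k, (T k s), s; auto.
Qed.

(** An enumeration by [P] uses only a finite part [D_k] of its oracle, so it suffices to guess [k]
    and check [Q] on each member, a quantifier bounded by [k]. The second oracle of [P] is taken
    empty, with index 0. *)
Lemma enum_op_oracle_subst P Q t :
  enum_op (fun A _ => P A) -> enum_op (fun A X z => Q A X (cfst z) (csnd z)) ->
  computable t -> enum_op (fun A X e => P (fun x => Q A X x e) (t e)).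
Proof.
  intros (F & c & mono & spec) hQ ht.
  apply (enum_op_ext (fun A X e => exists k, exists s,
    F k 0 s (t e) <> 0 /\ forall m, m < k -> bit k m = 0 \/ Q A X m e)).
  - intros A X e. rewrite (spec _ (fun _ => False)). split.
    + intros (k & s & h & hk). exists k, 0, s. split; [|auto using fin_in_0].
      intros m hm. destruct (hk m (canon_lt _ _ hm)) as [h0|h0]; auto.
      apply bit_canon in hm. contradiction.
    + intros (k & j & s & hk & hj & h). exists k, s. split.
      * revert h. apply mono; auto using fin_in_refl.
        intros m hm. destruct (hj m hm).
      * intros m _. destruct (Nat.eq_dec (bit k m) 0) as [h0|h0]; auto.
        right. apply hk, bit_canon, h0.
  - do 2 apply enum_op_ex. apply enum_op_and.
    + apply (enum_op_test (fun z => F (cfst (csnd z)) 0 (cfst z) (t (csnd (csnd z))))).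
      apply (computable_comp4 F); computable. apply (computable_comp t); computable.
    + apply (enum_op_ball (fun A X m z => bit (cfst (csnd z)) m = 0 \/
        Q A X m (csnd (csnd z)))); computable.
      apply enum_op_or.
      * apply enum_op_eq; computable. apply computable_bit; computable.
      * apply (enum_op_comp2 Q); computable.
Qed.

(** * The universal enumeration operator *)

(** This is the list coding that [encode] uses inside [PComp], so program lists and argument lists
    share the same decoders. *)
Fixpoint lcode (l : list nat) : nat :=
  match l with [] => 0 | x :: l' => S (cpair x (lcode l')) end.

Definition hdc (l : nat) : nat := cfst (pred l).
Definition tlc (l : nat) : nat := csnd (pred l).
Definition nthc (i l : nat) : nat := hdc (nat_rect (fun _ => nat) l (fun _ r => tlc r) i).

Lemma hdc_cons x l : hdc (S (cpair x l)) = x.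
Proof. apply cfst_cpair. Qed.

Lemma tlc_cons x l : tlc (S (cpair x l)) = l.
Proof. apply csnd_cpair. Qed.

Lemma cons_eta l : l <> 0 -> S (cpair (hdc l) (tlc l)) = l.
Proof. intros h. unfold hdc, tlc. rewrite cpair_eta. lia. Qed.

Lemma hdc_lcode xs : hdc (lcode xs) = hd 0 xs.
Proof. destruct xs; [apply cfst_0 | apply hdc_cons]. Qed.

Lemma tlc_lcode xs : tlc (lcode xs) = lcode (tl xs).
Proof. destruct xs; [apply csnd_0 | apply tlc_cons]. Qed.

Lemma nthc_lcode i xs : nthc i (lcode xs) = nth i xs 0.
Proof.
  unfold nthc.
  assert (e : forall xs, nat_rect (fun _ => nat) (lcode xs) (fun _ r => tlc r) i
    = lcode (skipn i xs)).
  { induction i as [|i IH]; intros ys; [reflexivity|].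
    cbn [nat_rect]. rewrite IH, tlc_lcode. f_equal. revert ys. clear.
    induction i as [|i IH]; intros [|y ys]; cbn; auto. }
  rewrite e, hdc_lcode. revert xs. clear.
  induction i as [|i IH]; intros [|x xs]; cbn; auto.
Qed.

Lemma lcode_inj xs ys : lcode xs = lcode ys -> xs = ys.
Proof.
  revert ys. induction xs as [|x xs IH]; intros [|y ys]; cbn; intros h;
    try discriminate; auto.
  injection h as h. apply cpair_inj in h as [-> h]. f_equal; auto.
Qed.

Lemma encode_PComp f gs :
  encode (PComp f gs) = cpair 3 (cpair (encode f) (lcode (map encode gs))).
Proof.
  cbn. f_equal. f_equal. induction gs as [|g gs IH]; cbn; [reflexivity|].
  now rewrite IH.
Qed.

Lemma prog_nested_ind (P : prog -> Prop) :
  P PZero -> P PSucc -> (forall i, P (PProj i)) ->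
  (forall f gs, P f -> Forall P gs -> P (PComp f gs)) ->
  (forall f g, P f -> P g -> P (PPrim f g)) ->
  (forall f, P f -> P (PMu f)) -> forall p, P p.
Proof.
  intros hZ hS hProj hComp hPrim hMu. fix F 1. intros [ | | i | f gs | f g | f].
  - exact hZ.
  - exact hS.
  - apply hProj.
  - apply hComp; [apply F|]. induction gs as [|g gs IH]; constructor; [apply F | exact IH].
  - apply hPrim; apply F.
  - apply hMu; apply F.
Qed.

Lemma encode_inj p q : encode p = encode q -> p = q.
Proof.
  revert q. induction p as [ | | i | f gs IHf IHgs | f g IHf IHg | f IHf]
    using prog_nested_ind; intros [ | | i' | f' gs' | f' g' | f'];
    rewrite ?encode_PComp; cbn [encode]; intros h; apply cpair_inj in h as [ht h];
    try discriminate ht; try (subst; reflexivity).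
  - apply cpair_inj in h as [h1 h2]. f_equal; [auto|].
    apply lcode_inj in h2. revert gs' h2.
    induction IHgs as [|g gs Hg Hgs IH]; intros [|g' gs'] h2; try discriminate; auto.
    injection h2 as h2 h3. f_equal; auto.
  - apply cpair_inj in h as [h1 h2]. f_equal; auto.
  - f_equal; auto.
Qed.

Lemma lcode_surj n : exists xs, lcode xs = n.
Proof.
  induction n as [n IH] using lt_wf_ind. destruct n as [|n].
  - exists []; reflexivity.
  - destruct (IH (csnd n)) as [xs h].
    + pose proof (csnd_le n). lia.
    + exists (cfst n :: xs). cbn. now rewrite h, cpair_eta.
Qed.

(** In the successor rule of primitive recursion the recursive premise concerns the whole code
    again, so the shape of the program has to be read off its tag. *)
Lemma encode_PPrim_inv p : cfst (encode p) = 4 -> exists f g, p = PPrim f g.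
Proof.
  destruct p; rewrite ?encode_PComp; cbn [encode]; rewrite cfst_cpair;
    intros h; try discriminate h; eauto.
Qed.

(* The judgments [p is a program], [gs is a list of programs], [eval p xs y] and
   [evals gs xs ys], on codes and tagged by 0, 1, 2, 3. *)
Definition fact (t a l y : nat) : Prop :=
  match t with
  | 0 => exists p, encode p = a
  | 1 => exists gs, lcode (map encode gs) = a
  | 2 => exists p xs, encode p = a /\ lcode xs = l /\ eval p xs y
  | 3 => exists gs xs ys,
      lcode (map encode gs) = a /\ lcode xs = l /\ lcode ys = y /\ evals gs xs ys
  | _ => False
  end.

(** The rules of program formation and evaluation, read on codes, with [X] as the judgments already
    derived. Tags 0 and 1 exist because the base case of primitive recursion never runs its step
    program: without the premise [X 0 (csnd (csnd a)) 0 0], codes of no program would be accepted.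
    Slots irrelevant to a judgment are set to 0. *)
Definition derivable (X : nat -> nat -> nat -> nat -> Prop) (t a l y : nat) : Prop :=
  (t = 0 /\ (a = cpair 0 0 \/ a = cpair 1 0 \/ cfst a = 2 \/
    (cfst a = 3 /\ X 0 (cfst (csnd a)) 0 0 /\ X 1 (csnd (csnd a)) 0 0) \/
    (cfst a = 4 /\ X 0 (cfst (csnd a)) 0 0 /\ X 0 (csnd (csnd a)) 0 0) \/
    (cfst a = 5 /\ X 0 (csnd a) 0 0))) \/
  (t = 1 /\ (a = 0 \/ (a <> 0 /\ X 0 (hdc a) 0 0 /\ X 1 (tlc a) 0 0))) \/
  (t = 2 /\ (
    (a = cpair 0 0 /\ y = 0) \/
    (a = cpair 1 0 /\ y = S (hdc l)) \/
    (cfst a = 2 /\ y = nthc (csnd a) l) \/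
    (cfst a = 3 /\ exists ys, X 3 (csnd (csnd a)) l ys /\ X 2 (cfst (csnd a)) ys y) \/
    (cfst a = 4 /\ l <> 0 /\ hdc l = 0 /\ X 2 (cfst (csnd a)) (tlc l) y /\
      X 0 (csnd (csnd a)) 0 0) \/
    (cfst a = 4 /\ l <> 0 /\ hdc l <> 0 /\ exists r,
      X 2 a (S (cpair (pred (hdc l)) (tlc l))) r /\
      X 2 (csnd (csnd a)) (S (cpair (pred (hdc l)) (S (cpair r (tlc l))))) y) \/
    (cfst a = 5 /\ X 2 (csnd a) (S (cpair y l)) 0 /\
      forall z, z < y -> exists r, X 2 (csnd a) (S (cpair z l)) (S r)))) \/
  (t = 3 /\ ((a = 0 /\ y = 0) \/
    (a <> 0 /\ y <> 0 /\ X 2 (hdc a) l (hdc y) /\ X 3 (tlc a) l (tlc y)))).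

Lemma fact_closed t a l y : derivable fact t a l y -> fact t a l y.
Proof.
  assert (eta : forall i, cfst a = i -> a = cpair i (csnd a))
    by (intros i <-; symmetry; apply cpair_eta).
  unfold derivable.
  intros [[-> H]|[[-> H]|[[-> H]|[-> H]]]]; cbn [fact] in *.
  - destruct H as [->|[->|[h|[(h & [p hp] & [gs hgs])|[(h & [p hp] & [q hq])|(h & [p hp])]]]]].
    + exists PZero; reflexivity.
    + exists PSucc; reflexivity.
    + exists (PProj (csnd a)). now rewrite (eta _ h) at 2.
    + exists (PComp p gs). rewrite encode_PComp, hp, hgs, cpair_eta. now rewrite <- eta.
    + exists (PPrim p q). cbn. rewrite hp, hq, cpair_eta. now rewrite <- eta.
    + exists (PMu p). cbn. rewrite hp. now rewrite <- eta.
  - destruct H as [->|(h & [p hp] & [gs hgs])].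
    + exists []; reflexivity.
    + exists (p :: gs). cbn. rewrite hp, hgs. now apply cons_eta.
  - destruct (lcode_surj l) as [xs hxs].
    destruct H as [[-> ->]|[[-> ->]|[[h ->]|[(h & ys & H1 & H2)|[(h & h0 & h1 & H1 & H2)|
      [(h & h0 & h1 & r & H1 & H2)|(h & H1 & H2)]]]]]]; subst l.
    + exists PZero, xs. repeat constructor.
    + exists PSucc, xs. rewrite hdc_lcode. repeat constructor.
    + exists (PProj (csnd a)), xs. rewrite nthc_lcode. repeat constructor.
      cbn. now rewrite <- eta.
    + destruct H1 as (gs & xs1 & ys1 & hgs & hxs1 & hys1 & H1).
      destruct H2 as (p & ys2 & hp & hys2 & H2).
      apply lcode_inj in hxs1 as ->. subst ys. apply lcode_inj in hys2 as ->.
      exists (PComp p gs), xs. split; [|split]; auto.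
      * rewrite encode_PComp, hp, hgs, cpair_eta. now rewrite <- eta.
      * eapply eComp; eauto.
    + destruct H1 as (p & xs1 & hp & hxs1 & H1). destruct H2 as (q & hq).
      destruct xs as [|x xs]; [contradiction|].
      rewrite hdc_lcode in h1. rewrite tlc_lcode in hxs1. cbn in h1, hxs1. subst x.
      apply lcode_inj in hxs1 as ->.
      exists (PPrim p q), (0 :: xs). split; [|split]; auto using ePrim0.
      cbn. rewrite hp, hq, cpair_eta. now rewrite <- eta.
    + destruct H1 as (p & xs1 & hp & hxs1 & H1). destruct H2 as (q & xs2 & hq & hxs2 & H2).
      destruct xs as [|x xs]; [contradiction|].
      rewrite hdc_lcode, tlc_lcode in *. cbn in h1, hxs1, hxs2. destruct x as [|n]; [lia|].
      apply (lcode_inj _ (n :: xs)) in hxs1 as ->.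
      apply (lcode_inj _ (n :: r :: xs)) in hxs2 as ->.
      exists p, (S n :: xs). split; [|split]; auto.
      destruct (encode_PPrim_inv p) as (f & g & ->); [congruence|].
      cbn in hp. rewrite <- hp, !csnd_cpair in hq. apply encode_inj in hq as ->.
      eapply ePrimS; eauto.
    + destruct H1 as (p & xs1 & hp & hxs1 & H1).
      apply (lcode_inj _ (y :: xs)) in hxs1 as ->.
      exists (PMu p), xs. split; [|split]; auto.
      * cbn. rewrite hp. now rewrite <- eta.
      * constructor; auto. intros z hz.
        destruct (H2 z hz) as (r & q & xs2 & hq & hxs2 & H3).
        apply (lcode_inj _ (z :: xs)) in hxs2 as ->. exists r.
        rewrite <- hp in hq. apply encode_inj in hq as ->. exact H3.
  - destruct H as [[-> ->]|(h & h0 & H1 & H2)].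
    + destruct (lcode_surj l) as [xs hxs]. exists [], xs, []. repeat constructor; auto.
    + destruct H1 as (p & xs & hp & hxs & H1).
      destruct H2 as (gs & xs' & ys & hgs & hxs' & hys & H2). subst l.
      apply lcode_inj in hxs' as ->.
      exists (p :: gs), xs, (hdc y :: ys). split; [|split; [|split]]; auto.
      * cbn. rewrite hp, hgs. now apply cons_eta.
      * cbn. rewrite hys. now apply cons_eta.
      * constructor; auto.
Qed.

Lemma fact_least (X : nat -> nat -> nat -> nat -> Prop) :
  (forall t a l y, derivable X t a l y -> X t a l y) ->
  forall t a l y, fact t a l y -> X t a l y.
Proof.
  intros closed.
  (* For tags 0 and 1 [fact] ignores [l] and [y], so [X] must be reached at all their values,
     although the rules only consult the value 0. *)
  assert (c0 : forall p l y, X 0 (encode p) l y).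
  { induction p as [ | | i | f gs IHf IHgs | f g IHf IHg | f IHf]
      using prog_nested_ind; intros l y; apply closed; left; split; auto.
    - right; right; left. apply cfst_cpair.
    - do 3 right; left. rewrite encode_PComp, !csnd_cpair, !cfst_cpair.
      split; [|split]; auto.
      induction IHgs as [|g gs Hg Hgs IH]; apply closed; right; left; split; auto.
      right. cbn. rewrite hdc_cons, tlc_cons. auto.
    - do 4 right; left. cbn. rewrite !csnd_cpair, !cfst_cpair. auto.
    - do 5 right. cbn. rewrite !csnd_cpair, !cfst_cpair. auto. }
  assert (c1 : forall gs l y, X 1 (lcode (map encode gs)) l y).
  { induction gs as [|g gs IH]; intros l y; apply closed; right; left; split; auto.
    right. cbn. rewrite hdc_cons, tlc_cons. auto. }
  assert (c2 : (forall p xs y, eval p xs y -> X 2 (encode p) (lcode xs) y) /\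
    (forall gs xs ys, evals gs xs ys ->
      X 3 (lcode (map encode gs)) (lcode xs) (lcode ys))).
  { apply (eval_evals_ind (fun p xs y => X 2 (encode p) (lcode xs) y)
      (fun gs xs ys => X 3 (lcode (map encode gs)) (lcode xs) (lcode ys))).
    - intros xs. apply closed; do 2 right; left; split; auto.
    - intros xs. apply closed; do 2 right; left; split; auto.
      right; left. now rewrite hdc_lcode.
    - intros i xs. apply closed; do 2 right; left; split; auto.
      do 2 right; left. cbn. now rewrite cfst_cpair, csnd_cpair, nthc_lcode.
    - intros f gs xs ys y IHs IH. apply closed; do 2 right; left; split; auto.
      do 3 right; left. rewrite encode_PComp, !csnd_cpair, !cfst_cpair.
      split; auto. exists (lcode ys); auto.
    - intros f g xs y IH. apply closed; do 2 right; left; split; auto.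
      do 4 right; left. rewrite hdc_lcode, tlc_lcode. cbn.
      rewrite !csnd_cpair, !cfst_cpair. repeat split; auto.
    - intros f g n xs r y IHr IH. apply closed; do 2 right; left; split; auto.
      do 5 right; left. rewrite hdc_lcode, tlc_lcode.
      split; [cbn; now rewrite cfst_cpair|]. split; [discriminate|]. split; [discriminate|].
      exists r. split; [exact IHr|]. cbn. rewrite !csnd_cpair. exact IH.
    - intros f xs y IH IHz. apply closed; do 2 right; left; split; auto.
      do 6 right. cbn. rewrite csnd_cpair, cfst_cpair. auto.
    - intros xs. apply closed; do 3 right; split; auto.
    - intros g gs xs y ys IH IHs. apply closed; do 3 right; split; auto.
      right. cbn. rewrite !hdc_cons, !tlc_cons. auto. }
  intros [|[|[|[|t]]]] a l y; cbn.
  - intros (p & <-). auto.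
  - intros (gs & <-). auto.
  - intros (p & xs & <- & <- & H). now apply c2.
  - intros (gs & xs & ys & <- & <- & <- & H). now apply c2.
  - intros [].
Qed.

Ltac enum_op :=
  repeat (lazymatch goal with
    | |- enum_op (fun A X e => _ /\ _) => apply enum_op_and
    | |- enum_op (fun A X e => _ \/ _) => apply enum_op_or
    | |- enum_op (fun A X e => exists y, _) => apply enum_op_ex
    | |- enum_op (fun A X e => forall y, y < _ -> _) => apply enum_op_ball
    | |- enum_op (fun A X e => _ <> 0) => apply enum_op_test
    | |- enum_op (fun A X e => _ = _) => apply enum_op_eq
    | |- enum_op (fun A X e => A _) => apply enum_op_oracle
    | |- enum_op (fun A X => A) => exact (enum_op_oracle _ computable_id)
    | |- enum_op (fun A X e => X _) => apply enum_op_oracle2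
    end); computable.

Lemma computable_hdc f : computable f -> computable (fun e => hdc (f e)).
Proof. intros hf. unfold hdc. computable. Qed.

Lemma computable_tlc f : computable f -> computable (fun e => tlc (f e)).
Proof. intros hf. unfold tlc. computable. Qed.

Lemma computable_nthc f g :
  computable f -> computable g -> computable (fun e => nthc (f e) (g e)).
Proof.
  intros hf hg. apply computable_hdc.
  apply (computable_rec g (fun _ r _ => tlc r)); computable.
Qed.

Opaque hdc tlc nthc.

(** The universal machine: quadruples become single numbers, [fact_closed] and [fact_least] exhibit
    [fact] as the least fixed point of [derivable], and [enum_op_lfp] enumerates it. *)
Lemma enum_op_W i x :
  computable i -> computable x -> enum_op (fun _ _ e => W (i e) (x e)).
Proof.
  intros hi hx.
  set (fact' := fun z => fact (cfst z) (cfst (csnd z)) (cfst (csnd (csnd z)))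
    (csnd (csnd (csnd z)))).
  set (quad := fun t a l y => cpair t (cpair a (cpair l y))).
  assert (fact'_quad : forall t a l y, fact' (quad t a l y) = fact t a l y).
  { intros. unfold fact', quad. now rewrite !csnd_cpair, !cfst_cpair. }
  assert (H : enum_op (fun _ _ => fact')).
  { apply (enum_op_lfp (fun _ X z => derivable (fun t a l y => X (quad t a l y))
      (cfst z) (cfst (csnd z)) (cfst (csnd (csnd z))) (csnd (csnd (csnd z))))
      (fun _ => fact')).
    - unfold derivable, quad. enum_op;
        repeat (first [apply computable_hdc | apply computable_tlc | apply computable_nthc];
          computable).
    - intros _ z h. apply fact_closed.
      replace (fun t a l y => fact' (quad t a l y)) with fact in h; auto.
      do 4 (apply functional_extensionality; intro). now rewrite fact'_quad.
    - intros _ X closed z h.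
      rewrite <- (cpair_eta z), <- (cpair_eta (csnd z)), <- (cpair_eta (csnd (csnd z))).
      apply (fact_least (fun t a l y => X (quad t a l y))); auto.
      intros t a l y hd. apply closed. 
      unfold quad in hd |- *. now rewrite !csnd_cpair, !cfst_cpair. }
  (* Tag 2 is the judgment of [eval], and [S (cpair (x e) 0)] is the code of the one-element list
     [[x e]]. *)
  apply (enum_op_ext (fun _ _ e => exists y, fact' (quad 2 (i e) (S (cpair (x e) 0)) y))).
  - intros A X e. unfold W. split.
    + intros [y h]. rewrite fact'_quad in h. destruct h as (p & xs & hp & hxs & h).
      apply (lcode_inj _ [x e]) in hxs as ->. eauto.
    + intros (p & hp & y & h). exists y. rewrite fact'_quad.
      exists p, [x e]. auto.
  - apply enum_op_ex. unfold quad.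
    apply (enum_op_subst (fun _ _ => fact') (fun e =>
      cpair 2 (cpair (i (csnd e)) (cpair (S (cpair (x (csnd e)) 0)) (cfst e)))));
      auto. computable.
    + apply (computable_comp i); computable.
    + apply (computable_comp x); computable.
Qed.

Lemma set_ext (A B : nat -> Prop) : (forall x, A x <-> B x) -> A = B.
Proof.
  intros h. apply functional_extensionality; intros x.
  now apply propositional_extensionality.
Qed.

Lemma enum_op_Gamma_univ : enum_op (fun A _ e => Gamma (cfst e) A (csnd e)).
Proof.
  apply (enum_op_ext (fun A X e => exists k, W (cfst e) (cpair (csnd e) k) /\
    forall m, m < k -> bit k m = 0 \/ A m)).
  - intros A X e. split.
    + intros (k & hW & h). exists k. split; auto. intros m hm.
      apply bit_canon in hm. destruct (h m) as [h0|h0]; auto; [|contradiction].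
      apply bit_canon in hm. now apply canon_lt.
    + intros (k & hW & h). exists k. split; auto. intros m _.
      destruct (Nat.eq_dec (bit k m) 0) as [h0|h0]; auto.
      right. now apply h, bit_canon.
  - enum_op.
    + apply enum_op_W; computable.
    + apply computable_bit; computable.
Qed.

Lemma enum_op_Gamma Q i n :
  enum_op (fun A X z => Q A X (cfst z) (csnd z)) -> computable i -> computable n ->
  enum_op (fun A X e => Gamma (i e) (fun x => Q A X x e) (n e)).
Proof.
  intros hQ hi hn.
  apply (enum_op_ext (fun A X e => (fun B z => Gamma (cfst z) B (csnd z))
    (fun x => Q A X x e) (cpair (i e) (n e)))).
  - intros A X e. cbv beta. now rewrite cfst_cpair, csnd_cpair.
  - apply (enum_op_oracle_subst (fun B z => Gamma (cfst z) B (csnd z)) Q);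
      computable; auto using enum_op_Gamma_univ.
Qed.

(** The converse passage, from [enum_op] to an index: [PMu] searches for a stage [s] at which
    [1 - F k 0 s x] vanishes, so its domain is the required set of pairs. As [P] does not see the
    second oracle, its finite part may be taken empty. *)
Lemma enum_op_index P : enum_op (fun A _ => P A) -> exists i, forall A, Gamma i A = P A.
Proof.
  intros (F & c & mono & spec).
  assert (hg : computable (fun w => 1 - F (csnd (csnd w)) 0 (cfst w) (cfst (csnd w)))).
  { computable. apply (computable_comp4 F); computable. }
  assert (ht : tot (fun xs => 1 - F (csnd (nth 1 xs 0)) 0 (nth 0 xs 0) (cfst (nth 1 xs 0)))).
  { assert (e : (fun xs => 1 - F (csnd (nth 1 xs 0)) 0 (nth 0 xs 0) (cfst (nth 1 xs 0)))
      = fun xs : list nat => (fun w => 1 - F (csnd (csnd w)) 0 (cfst w) (cfst (csnd w)))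
        (cpair (nth 0 xs 0) (nth 1 xs 0))).
    { apply functional_extensionality; intros xs. now rewrite !csnd_cpair, !cfst_cpair. }
    rewrite e. apply (tot_comp1
      (fun w => 1 - F (csnd (csnd w)) 0 (cfst w) (cfst (csnd w)))); auto.
    apply tot_cpair; apply tot_nth. }
  destruct ht as [g hg'].
  assert (hW : forall x k, W (encode (PMu g)) (cpair x k) <-> exists s, F k 0 s x <> 0).
  { intros x k.
    assert (hgs : forall s, eval g [s; cpair x k] (1 - F k 0 s x)).
    { intros s. specialize (hg' [s; cpair x k]). cbn in hg'.
      now rewrite csnd_cpair, cfst_cpair in hg'. }
    split.
    - intros (p & hp & y & h). apply encode_inj in hp as ->.
      inversion h as [ | | | | | | f0 xs0 y0 h0 _]; subst. exists y.
      pose proof (eval_functional _ _ _ _ (hgs y) h0). lia.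
    - intros (s & hs). exists (PMu g). split; auto.
      (* The rule for [PMu] demands positive values before the zero, so the first successful stage
         has to be used. *)
      assert (least : exists y, F k 0 y x <> 0 /\ forall z, z < y -> F k 0 z x = 0).
      { revert hs. induction s as [s IH] using lt_wf_ind. intros hs.
        destruct (classic (exists z, z < s /\ F k 0 z x <> 0)) as [(z & hz & h)|h].
        - eauto.
        - exists s. split; auto. intros z hz.
          destruct (Nat.eq_dec (F k 0 z x) 0); auto. destruct h; eauto. }
      destruct least as (y & hy & hz). exists y. constructor.
      + replace 0 with (1 - F k 0 y x) by lia. apply hgs.
      + intros z h. exists 0. replace 1 with (1 - F k 0 z x); [apply hgs|].
        rewrite hz; auto. }
  exists (encode (PMu g)). intros A. apply set_ext; intros x.
  rewrite (spec A (fun _ => False)). unfold Gamma. split.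
  - intros (k & h & hk). apply hW in h as [s h]. exists k, 0, s. auto using fin_in_0.
  - intros (k & j & s & hk & hj & h). exists k. split; auto. apply hW. exists s.
    revert h. apply mono; auto using fin_in_refl. intros m hm. destruct (hj m hm).
Qed.

Lemma Gamma_mono i (A B : nat -> Prop) :
  (forall x, A x -> B x) -> forall x, Gamma i A x -> Gamma i B x.
Proof. intros h x (k & hW & hk). exists k. auto. Qed.

Definition Gamma_iter (i n : nat) (A : nat -> Prop) : nat -> Prop :=
  nat_rect (fun _ => nat -> Prop) A (fun _ B => Gamma i B) n.

Lemma Gamma_iter_S i n A : Gamma_iter i (1 + n) A = Gamma i (Gamma_iter i n A).
Proof. reflexivity. Qed.

(** Uniformity in the number of iterations: the set of pairs of [k] and an element of the [k]-th
    iterate is the least fixed point of a one-step recursion in [k]. *)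
Lemma enum_op_Gamma_iter Q i m n :
  enum_op (fun A X z => Q A X (cfst z) (csnd z)) -> computable m -> computable n ->
  enum_op (fun A X e => Gamma_iter i (m e) (fun x => Q A X x e) (n e)).
Proof.
  intros hQ hm hn.
  apply (enum_op_ext (fun A X e => (fun B z => Gamma_iter i (cfst z) B (csnd z))
    (fun x => Q A X x e) (cpair (m e) (n e)))).
  { intros A X e. cbv beta. now rewrite cfst_cpair, csnd_cpair. }
  apply (enum_op_oracle_subst (fun B z => Gamma_iter i (cfst z) B (csnd z)) Q);
    computable; auto.
  apply (enum_op_lfp (fun A X z => (cfst z = 0 /\ A (csnd z)) \/
    (cfst z <> 0 /\ Gamma i (fun x => X (cpair (pred (cfst z)) x)) (csnd z)))
    (fun B z => Gamma_iter i (cfst z) B (csnd z))).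
  - enum_op.
    apply (enum_op_Gamma (fun A X x z => X (cpair (pred (cfst z)) x)) (fun _ => i));
      enum_op.
  - intros A z. intros [[-> h]|[h0 h]]; [exact h|].
    destruct (cfst z) as [|k]; [contradiction|]. revert h. apply Gamma_mono.
    intros x h. cbn in h. now rewrite cfst_cpair, csnd_cpair in h.
  - intros A X closed.
    assert (h : forall k x, Gamma_iter i k A x -> X (cpair k x)).
    { induction k as [|k IH]; intros x h; apply closed; rewrite cfst_cpair, csnd_cpair.
      - left; auto.
      - right. split; [discriminate|]. revert h. apply Gamma_mono. exact IH. }
    intros z hz. rewrite <- (cpair_eta z). auto.
Qed.

Ltac enum_Gamma :=
  enum_op;
  repeat (first [apply enum_op_Gamma | apply enum_op_Gamma_iter]; enum_op).

(** * Enumeration reducibility *)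

Lemma e_le_enum_op P B : enum_op (fun A _ => P A) -> e_le (P B) B.
Proof. intros h. destruct (enum_op_index P h) as [i hi]. exists i. apply hi. Qed.

Lemma e_le_trans A B C : e_le A B -> e_le B C -> e_le A C.
Proof.
  intros [i <-] [j <-]. apply (e_le_enum_op (fun A => Gamma i (Gamma j A))).
  enum_Gamma.
Qed.

(** * Columns, joins, and the degree of [A] *)

Definition sect (t : nat) (S : nat -> Prop) : nat -> Prop := fun x => S (cpair t x).

Definition join (B C : nat -> Prop) : nat -> Prop :=
  fun x => (cfst x = 0 /\ B (csnd x)) \/ (cfst x = 1 /\ C (csnd x)).

Definition empty : nat -> Prop := fun _ => False.

Lemma sect0_join B C : sect 0 (join B C) = B.
Proof.
  apply set_ext; intros x. unfold sect, join. rewrite cfst_cpair, csnd_cpair.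
  intuition discriminate.
Qed.

Lemma sect1_join B C : sect 1 (join B C) = C.
Proof.
  apply set_ext; intros x. unfold sect, join. rewrite cfst_cpair, csnd_cpair.
  intuition discriminate.
Qed.

Lemma join_mono (B C B' C' : nat -> Prop) :
  (forall x, B x -> B' x) -> (forall x, C x -> C' x) -> forall x, join B C x -> join B' C' x.
Proof. unfold join. firstorder. Qed.

Lemma enum_op_join P Q :
  enum_op (fun A _ => P A) -> enum_op (fun A _ => Q A) ->
  enum_op (fun A _ => join (P A) (Q A)).
Proof.
  intros hP hQ. unfold join. enum_op.
  - apply (enum_op_subst (fun A _ => P A)); computable; auto.
  - apply (enum_op_subst (fun A _ => Q A)); computable; auto.
Qed.

Lemma enum_op_empty : enum_op (fun _ _ => empty).
Proof.
  apply (enum_op_ext (fun _ _ _ => 0 <> 0)); [unfold empty; lia | enum_op].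
Qed.

Lemma enum_op_sect t : enum_op (fun A _ => sect t A).
Proof. unfold sect. enum_op. Qed.

Lemma enum_op_Gamma_const i P :
  enum_op (fun A _ => P A) -> enum_op (fun A _ => Gamma i (P A)).
Proof.
  intros h. apply (enum_op_Gamma (fun A _ x _ => P A x) (fun _ => i) (fun e => e));
    computable. apply (enum_op_subst (fun A _ => P A)); computable; auto.
Qed.

Lemma e_le_join A B C : e_le B A -> e_le C A -> e_le (join B C) A.
Proof.
  intros [i <-] [j <-]. apply (e_le_enum_op (fun A => join (Gamma i A) (Gamma j A))).
  apply enum_op_join; apply enum_op_Gamma_const; enum_op.
Qed.

Lemma e_le_empty A : e_le empty A.
Proof. exact (e_le_enum_op (fun _ => empty) A enum_op_empty). Qed.

(** The operator reads column [t] only, so [r] is chosen before [X] and serves all sets sharing that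
    column. *)
Lemma e_le_sect_uniform t A B :
  e_le A B -> exists r, forall X, sect t X = B -> Gamma r X = A.
Proof.
  intros [i hi].
  destruct (enum_op_index (fun X => Gamma i (sect t X))) as [r hr].
  - apply enum_op_Gamma_const, enum_op_sect.
  - exists r. intros X h. now rewrite hr, h.
Qed.

Lemma edeg_Gamma A B i j : edeg A B -> Gamma j (Gamma i B) = B -> edeg A (Gamma i B).
Proof.
  intros [h1 h2] h. split.
  - apply e_le_trans with B; auto. now exists i.
  - apply e_le_trans with B; auto. now exists j.
Qed.

(** The order of quantifiers is the point: [a] depends on the move [i], [j] alone and works for
    every [B], for an arbitrary [u]. *)
Lemma uniformity_transport A f u :
  uniformity_fun (edeg A) f u -> forall i j, exists a,
  forall B, edeg A B -> Gamma j (Gamma i B) = B -> f (Gamma i B) = Gamma a (f B).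
Proof.
  intros hu i j. exists (cfst (u (cpair i j))). intros B hB h.
  destruct (hu B (Gamma i B) hB (edeg_Gamma A B i j hB h) i j) as (a & b & hab & h1 & _).
  - exists i, j. auto.
  - now rewrite hab, cfst_cpair, h1.
Qed.

Lemma KA_Gamma A x : KA A x <-> Gamma (cfst x) A (csnd x).
Proof.
  split.
  - intros (i & n & -> & h). now rewrite cfst_cpair, csnd_cpair.
  - intros h. exists (cfst x), (csnd x). now rewrite cpair_eta.
Qed.

(** [A] is the column of K_A at an index of the identity operator. *)
Lemma e_le_KA A : e_le A (KA A).
Proof.
  destruct (enum_op_index (fun A => A)) as [i hi]; [enum_op|].
  replace A with (sect i (KA A)) at 1.
  - apply (e_le_enum_op (sect i)), enum_op_sect.
  - apply set_ext; intros x. unfold sect.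
    now rewrite KA_Gamma, cfst_cpair, csnd_cpair, hi.
Qed.

(* [join (eq n) S] tags [S] with [n]. The family [X n = P] or [X n = R], according
   to [n] being outside or inside [K_A], is reached from [A] by moves taken from a
   finite list: tag by 0, increment the tag [n] times, pass from [A] to [X n]
   reading [n] off the tag, decrement the tag [n] times, and untag. Hence [f (X n)]
   is enumerated from [f A] uniformly in [n], although the uniformity function
   need not be computable. *)
Lemma nonconstant_on_nested_pair A f P R r :
  unif_e_invariant (edeg A) f -> (forall x, P x -> R x) -> e_le P A -> e_le R A ->
  Gamma r P = A -> Gamma r R = A -> f P <> f R ->
  e_le A (f A) \/ e_le (skip A) (f A).
Proof.
  intros [u hu] hPR [p hp] [q hq] hrP hrR hne.
  set (X := fun n y => P y \/ (KA A n /\ R y)).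
  assert (hXin : forall n, KA A n -> X n = R) 
    by (intros n h; apply set_ext; intros y; specialize (hPR y); unfold X; tauto).
  assert (hXout : forall n, ~ KA A n -> X n = P) 
    by (intros n h; apply set_ext; intros y; specialize (hPR y); unfold X; tauto).
  assert (hXr : forall n, Gamma r (X n) = A).
  { intros n. destruct (classic (KA A n)) as [h|h];
      [rewrite hXin by auto | rewrite hXout by auto]; auto. }
  set (T := fun n S => join (eq n) S).
  destruct (enum_op_index (fun S => T 0 S)) as [tag0 htag0].
  { apply enum_op_join; [apply (enum_op_eq (fun _ => 0) (fun e => e)); computable | enum_op]. }
  destruct (enum_op_index (sect 1)) as [untag huntag]; [apply enum_op_sect|].
  destruct (enum_op_index (fun S =>
    join (fun m => exists n, sect 0 S n /\ 1 + n = m) (sect 1 S))) as [incr hincr].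
  { apply enum_op_join; [unfold sect; enum_op| apply enum_op_sect]. }
  destruct (enum_op_index (fun S =>
    join (fun m => sect 0 S (1 + m)) (sect 1 S))) as [decr hdecr].
  { apply enum_op_join; [unfold sect; enum_op| apply enum_op_sect]. }
  (* [switch] reads [n] off the tag column, tests membership in K_A by running operator [cfst n],
     and rebuilds [P] and [R] through [p] and [q]. The tag is kept, to be counted down
     afterwards. *)
  destruct (enum_op_index (fun S => join (sect 0 S) (fun y => Gamma p (sect 1 S) y \/
    exists n, sect 0 S n /\ Gamma (cfst n) (sect 1 S) (csnd n) /\ Gamma q (sect 1 S) y)))
    as [switch hswitch].
  { apply enum_op_join; [apply enum_op_sect|]. unfold sect; enum_Gamma. }
  destruct (enum_op_index (fun S => join (sect 0 S) (Gamma r (sect 1 S)))) as [back hback].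
  { apply enum_op_join; [apply enum_op_sect | apply enum_op_Gamma_const, enum_op_sect]. }
  assert (Ttag0 : forall S, Gamma tag0 S = T 0 S) by auto.
  assert (Tuntag : forall S, Gamma untag (T 0 S) = S).
  { intros S. rewrite huntag. apply sect1_join. }
  assert (Tincr : forall n S, Gamma incr (T n S) = T (1 + n) S).
  { intros n S. rewrite hincr. unfold T. rewrite sect0_join, sect1_join. f_equal.
    apply set_ext; intros m. split; [intros (? & -> & <-) | intros <-]; eauto. }
  assert (Tdecr : forall n S, Gamma decr (T (1 + n) S) = T n S).
  { intros n S. rewrite hdecr. unfold T. rewrite sect0_join, sect1_join. f_equal.
    apply set_ext; intros m. lia. }
  assert (Tswitch : forall n, Gamma switch (T n A) = T n (X n)).
  { intros n. rewrite hswitch. unfold T. rewrite sect0_join, sect1_join, hp, hq. f_equal.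
    apply set_ext; intros y. unfold X. rewrite KA_Gamma.
    split; [intros [h|(m & <- & h)]; auto | intros [h|h]; eauto]. }
  assert (Tback : forall n, Gamma back (T n (X n)) = T n A).
  { intros n. rewrite hback. unfold T. now rewrite sect0_join, sect1_join, hXr. }
  assert (hA : edeg A A) by (split; apply (e_le_enum_op (fun A => A)); enum_op).
  assert (degTA : forall n, edeg A (T n A)).
  { induction n as [|n IH].
    - rewrite <- Ttag0. apply (edeg_Gamma A A tag0 untag); auto. now rewrite Ttag0.
    - change (S n) with (1 + n). rewrite <- Tincr.
      apply (edeg_Gamma A (T n A) incr decr); auto. now rewrite Tincr. }
  (* [switch] reaches [X n] only under the tag [n]; other tags are obtained by going down to 0 and
     up again. *)
  assert (degTX : forall n m, edeg A (T m (X n))).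
  { intros n.
    assert (h : edeg A (T n (X n))).
    { rewrite <- Tswitch. apply (edeg_Gamma A (T n A) switch back); auto.
      now rewrite Tswitch. }
    assert (h0 : edeg A (T 0 (X n))).
    { assert (down : forall k, edeg A (T k (X n)) -> edeg A (T 0 (X n))).
      { induction k as [|k IH]; intros hk; auto. apply IH. rewrite <- Tdecr.
        apply (edeg_Gamma A (T (1 + k) (X n)) decr incr); auto. now rewrite Tdecr. }
      eauto. }
    induction m as [|m IH]; auto. change (S m) with (1 + m). rewrite <- Tincr.
    apply (edeg_Gamma A (T m (X n)) incr decr); auto. now rewrite Tincr. }
  destruct (uniformity_transport A f u hu tag0 untag) as [a_tag0 ftag0].
  destruct (uniformity_transport A f u hu untag tag0) as [a_untag funtag].
  destruct (uniformity_transport A f u hu incr decr) as [a_incr fincr].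
  destruct (uniformity_transport A f u hu decr incr) as [a_decr fdecr].
  destruct (uniformity_transport A f u hu switch back) as [a_switch fswitch].
  (* The images under [f] of the five moves; [n] enters only through the two iteration counts, never
     through an index. *)
  set (Z := fun n S => Gamma a_untag (Gamma_iter a_decr n
    (Gamma a_switch (Gamma_iter a_incr n (Gamma a_tag0 S))))).
  assert (hZ : forall n, f (X n) = Z n (f A)).
  { intros n. unfold Z.
    assert (up : Gamma_iter a_incr n (Gamma a_tag0 (f A)) = f (T n A)).
    { clear - ftag0 fincr Ttag0 Tuntag Tincr Tdecr hA degTA. induction n as [|n IH].
      - rewrite <- Ttag0. symmetry. apply ftag0; auto. now rewrite Ttag0.
      - change (S n) with (1 + n). rewrite <- Tincr, Gamma_iter_S, IH.
        symmetry. apply fincr; auto. now rewrite Tincr. }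
    (* [Gamma_iter_S] peels off the last decrement, so the final tag [i] must vary in the
       induction. *)
    assert (down : forall j i, Gamma_iter a_decr j (f (T (j + i) (X n))) = f (T i (X n))).
    { induction j as [|j IH]; intros i; [reflexivity|].
      replace (S j + i) with (j + (1 + i)) by lia.
      change (S j) with (1 + j). rewrite Gamma_iter_S, IH, <- fdecr by (auto; now rewrite Tdecr).
      now rewrite Tdecr. }
    rewrite up, <- fswitch by (auto; now rewrite Tswitch). rewrite Tswitch.
    specialize (down n 0). rewrite Nat.add_0_r in down. rewrite down.
    rewrite <- funtag by (auto; now rewrite Tuntag). now rewrite Tuntag. }
  assert (hle : forall k, e_le (fun n => f (X n) k) (f A)).
  { intros k. replace (fun n => f (X n) k) with (fun n => Z n (f A) k)
      by (apply functional_extensionality; intros n; now rewrite hZ).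
    apply (e_le_enum_op (fun S n => Z n S k)). unfold Z. enum_Gamma. }
  assert (hk : exists k, ~ (f P k <-> f R k)).
  { apply not_all_ex_not. intros h. apply hne, set_ext, h. }
  destruct hk as [k hk].
  destruct (classic (f R k)) as [hRk|hRk].
  - left. apply e_le_trans with (fun n => f (X n) k); auto.
    replace (fun n => f (X n) k) with (KA A).
    + apply e_le_KA.
    + apply set_ext; intros n. destruct (classic (KA A n)) as [h|h];
        [rewrite hXin by auto | rewrite hXout by auto]; tauto.
  - right. replace (skip A) with (fun n => f (X n) k); auto.
    apply set_ext; intros n. unfold skip. destruct (classic (KA A n)) as [h|h];
      [rewrite hXin by auto | rewrite hXout by auto]; tauto.
Qed.

Theorem theorem5p1 (A : nat -> Prop) (f : (nat -> Prop) -> (nat -> Prop)) :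
  unif_e_invariant (edeg A) f ->
  (exists B C, edeg A B /\ edeg A C /\ f B <> f C) ->
  e_le A (f A) \/ e_le (skip A) (f A).
Proof.
  intros hf (B & C & [hB hB'] & [hC hC'] & hne).
  assert (pair : forall t P R S, (forall x, P x -> R x) -> e_le P A -> e_le R A ->
    e_le A S -> sect t P = S -> sect t R = S -> f P <> f R ->
    e_le A (f A) \/ e_le (skip A) (f A)).
  { intros t P R S hPR hP hR hS hPS hRS h.
    destruct (e_le_sect_uniform t A S hS) as [r hr].
    apply (nonconstant_on_nested_pair A f P R r); auto. }
  (* One operator [a] recovers [f S] from [f (join S empty)] for all [S] in the degree, so equal
     values at the joins would force [f B = f C]. *)
  assert (hne' : f (join B empty) <> f (join C empty)).
  { destruct hf as [u hu].
    destruct (enum_op_index (sect 0)) as [i hi]; [apply enum_op_sect|].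
    destruct (enum_op_index (fun S => join S empty)) as [j hj].
    { apply enum_op_join; [enum_op | apply enum_op_empty]. }
    destruct (uniformity_transport A f u hu i j) as [a ha].
    assert (h : forall S, edeg A S -> f S = Gamma a (f (join S empty))).
    { intros S hS. rewrite <- ha, hi, sect0_join; auto.
      - rewrite <- hj. apply (edeg_Gamma A S j i); auto. now rewrite hj, hi, sect0_join.
      - now rewrite hj, hi, sect0_join. }
    intros e. apply hne. rewrite (h B), (h C), e by (split; auto). reflexivity. }
  (* At each link of the chain, an inequality is settled by [pair], whose first argument names the
     column that both joins share. *)
  destruct (classic (f (join B empty) = f (join B C))) as [e1|e1].
  2: { apply (pair 0 (join B empty) (join B C) B); auto using sect0_join, e_le_join, e_le_empty.
    apply join_mono; unfold empty; tauto. }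
  destruct (classic (f (join empty C) = f (join B C))) as [e2|e2].
  2: { apply (pair 1 (join empty C) (join B C) C); auto using sect1_join, e_le_join, e_le_empty.
    apply join_mono; unfold empty; tauto. }
  destruct (classic (f (join empty C) = f (join C C))) as [e3|e3].
  2: { apply (pair 1 (join empty C) (join C C) C); auto using sect1_join, e_le_join, e_le_empty.
    apply join_mono; unfold empty; tauto. }
  (* [e1], [e2] and [e3] identify [f (join B empty)] with [f (join C C)], so by [hne'] the last link
     is the one that breaks. *)
  apply (pair 0 (join C empty) (join C C) C);
    auto using sect0_join, e_le_join, e_le_empty.
  { apply join_mono; unfold empty; tauto. }
  congruence.
Qed.
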